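(* For any integer $k > 3$, $SP(3k-1,k) \geq 3k-1$.
   Context: A $k$-partition of a finite set $X$ is a collection of exactly $k$ pairwise disjoint non-empty subsets of $X$ (called classes) whose union is $X$. A Sperner $k$-partition system on $X$ is a set $\mathcal{P}$ of $k$-partitions of $X$ such that for any two distinct partitions $P, Q \in \mathcal{P}$, no class of $P$ is a subset of (in particular, equal to) a class of $Q$. $SP(n,k)$ denotes the maximum number of partitions in a Sperner $k$-partition system on a set of $n$ elements. *)

(* Defs.v *)
From mathcomp Require Import all_boot.

Set Implicit Arguments.
Unset Strict Implicit.
Unset Printing Implicit Defensive.

Definition kpartition (T : finType) (k : nat) (P : {set {set T}}) : bool :=
  partition P [set: T] && (#|P| == k).

Definition sperner_system (T : finType) (k : nat)
    (S : {set {set {set T}}}) : bool :=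
  [forall P in S, kpartition k P] &&
  [forall P in S, forall Q in S, (P != Q) ==>
     [forall A in P, forall B in Q, ~~ (A \subset B)]].

(* The ground set is 'I_n; the maximum is over a non-empty family, since the
   empty system always qualifies. *)
Definition SP (n k : nat) : nat :=
  \max_(S : {set {set {set 'I_n}}} | sperner_system k S) #|S|.

(* Main.v *)
Require Import Defs.
From mathcomp Require Import all_boot.
From mathcomp Require Import zify.

Set Implicit Arguments.
Unset Strict Implicit.
Unset Printing Implicit Defensive.

(** Write [k = m + 1] and [n = 3m + 2], so that a [k]-partition of the integers
    modulo [n] can consist of one pair and [m] triples.  The system is made of
    the [n] translates of a single such partition ([SP_cyclic]); it is Sperner
    as soon as no translate of a class by a non-zero [t] is contained in a
    class.

    The pair is [{3m, 3m + 1}], so no triple may contain two cyclically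
    consecutive points.  A triple [a < b < z] is determined up to translation
    by the cyclic order of its gaps [(b - a, z - b, n + a - z)], so the gaps of
    the triples must be pairwise different up to rotation, and no triple may be
    a rotation of itself; the latter is automatic because 3 does not divide
    [n].

    The triples [{c, m + c, 3m - 1 - c}] for [c < m] almost work: their gaps
    are [(m, 2m - 1 - 2c, 2c + 3)].  Two defects remain.  For [c = m - 1] the
    second gap is 1; and for [m] odd the triples with [c = (m - 1)/2] and
    [c = (m - 3)/2] have gaps [(m, m, m + 2)] and [(m, m + 2, m)], which are
    rotations of each other.  Exchanging the middle points of the triples
    [c = m - 1] and [c = j], where [j] is the integer part of [(m - 1)/2],
    repairs both at once: the two new triples have gaps [(j + 1, m - j, 2m + 1)]
    and [(2m - 1 - j, m - j, 2j + 3)], none of which is 1 or [m] when [m >= 3],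
    whereas every other triple has the gap [m].  For the triples left unchanged
    the two gaps other than [m] are odd.  If [m] is even, two of them with the
    same gaps up to rotation therefore have the same last gap and coincide.  If
    [m] is odd, one of those two gaps equals [m] only for [c = (m - 1)/2 = j],
    which has been changed, and for [c = (m - 3)/2]; again no two agree.  Each of
    the new triples differs from the other because [2m + 1] is a gap of the
    first only. *)

(** * Partition systems from colourings *)

(** If no class of one colouring lies inside a class of another, the induced
    partitions are automatically distinct, since a class lies inside itself. *)
Lemma SP_colourings (n : nat) (I K : finType) (f : I -> 'I_n -> K) :
  0 < #|K| ->
  (forall s c, exists x, f s x = c) ->
  (forall s s' c c', s != s' -> exists2 x, f s x = c & f s' x != c') ->
  #|I| <= SP n #|K|.
Proof.
move=> K_gt0 f_onto f_sperner.
pose B s c := [set x | f s x == c].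
pose P s := [set B s c | c in K].
have PP s : kpartition #|K| (P s).
  have [|c _|partP injB] := @indexed_partition K 'I_n K (B s).
  - move=> c c' _ _ ne_c; apply/pred0P=> x /=; rewrite !inE.
    apply/negP=> /andP[/eqP eq_c /eqP eq_c'].
    by rewrite -eq_c -eq_c' eqxx in ne_c.
  - by have [x fx] := f_onto s c; apply/set0Pn; exists x; rewrite inE fx.
  rewrite /kpartition card_in_imset // eqxx andbT.
  suff <- : cover (P s) = [set: 'I_n] by [].
  apply/setP=> x; rewrite inE; apply/bigcupP; exists (B s (f s x)).
    exact: imset_f.
  by rewrite inE.
have incomparable s s' A A' :
    s != s' -> A \in P s -> A' \in P s' -> ~~ (A \subset A').
  move=> ne_s /imsetP[c _ ->] /imsetP[c' _ ->].
  have [x fx f'x] := f_sperner s s' c c' ne_s.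
  by apply/subsetPn; exists x; rewrite inE ?fx.
have injP : injective P.
  move=> s s' eq_P; apply/eqP/negPn/negP=> ne_s.
  have /card_gt0P[c _] := K_gt0.
  have Bc : B s c \in P s by apply: imset_f.
  by have := incomparable s s' _ _ ne_s Bc; rewrite -eq_P => /(_ _ Bc)/subsetP[].
rewrite -(card_imset predT injP).
apply: (leq_bigmax_cond (F := fun S : {set {set {set 'I_n}}} => #|S|)).
apply/andP; split; first by apply/forall_inP=> _ /imsetP[s _ ->].
apply/forall_inP=> _ /imsetP[s _ ->]; apply/forall_inP=> _ /imsetP[s' _ ->].
apply/implyP=> ne_P; apply/forall_inP=> A PA; apply/forall_inP=> A' PA'.
by apply: incomparable PA PA'; apply: contraNneq ne_P => ->.
Qed.

(** The system consists of all the translates of one colouring; whether a class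
    of the translate by [s] lies in a class of the translate by [s'] depends
    only on [s' - s] modulo [n], so one of the two may be taken to be the
    original. *)
Lemma SP_cyclic (n k : nat) (col : nat -> 'I_k) :
  0 < k ->
  (forall c, exists2 p, p < n & col p = c) ->
  (forall t c c', 0 < t < n ->
     exists p, [/\ p < n, col p = c & col ((p + t) %% n) != c']) ->
  n <= SP n k.
Proof.
move=> k_gt0 col_onto col_sperner.
(* Subtracting [s] modulo [n]: [x] is the point that the [s]-th colouring sees
   as [p]. *)
have shift (s : 'I_n) p : p < n ->
    exists x : 'I_n, forall u, (x + u) %% n = (p + (n - s + u)) %% n.
  move=> lt_pn.
  have n_gt0 : 0 < n by apply: leq_trans lt_pn.
  exists (Ordinal (ltn_pmod (p + (n - s)) n_gt0)) => u /=.
  by rewrite modnDml addnA.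
have shiftK (s : 'I_n) p : p < n -> (p + (n - s + s)) %% n = p.
  by move=> lt_pn; rewrite subnK ?(ltnW (ltn_ord s)) // modnDr modn_small.
rewrite -[in X in X <= _](card_ord n) -[in SP n k](card_ord k).
apply: (@SP_colourings n _ _ (fun s x : 'I_n => col ((x + s) %% n))).
- by rewrite card_ord.
- move=> s c; have [p lt_pn <-] := col_onto c.
  by have [x xP] := shift s p lt_pn; exists x; rewrite xP shiftK.
move=> s s' c c' ne_s.
have t_bounds : 0 < (n - s + s') %% n < n.
  have := ltn_ord s; have := ltn_ord s'; move: ne_s; rewrite -val_eqE /=.
  move: (val s) (val s') => a b ne_ab lt_bn lt_an.
  rewrite ltn_pmod ?andbT; last by lia.
  case: (leqP a b) => le_ab; last by rewrite modn_small; lia.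
  rewrite (_ : n - a + b = b - a + n); last by lia.
  by rewrite modnDr modn_small; lia.
have [p [lt_pn col_p col_pt]] := col_sperner _ c c' t_bounds.
have [x xP] := shift s p lt_pn; exists x; first by rewrite xP shiftK.
by rewrite xP -modnDmr.
Qed.

(** * Triples up to translation *)

Lemma modn_add_cases p t n : p < n -> t < n ->
  (p + t) %% n = p + t \/ (p + t) %% n + n = p + t.
Proof.
move=> lt_pn lt_tn; case: (ltnP (p + t) n) => [lt_ptn | le_npt].
  by left; rewrite modn_small.
by right; rewrite -{1}(subnK le_npt) modnDr modn_small ?subnK //; lia.
Qed.

(** A translation preserves the cyclic order, so it can only rotate the gaps.
    If it does not rotate them then, being non-trivial, it moves the smallest
    point. *)
Lemma translate_triple n t a b z a' b' z' :
  0 < t < n -> a < b -> b < z -> z < n -> a' < b' -> b' < z' -> z' < n ->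
  (forall p, p \in [:: a; b; z] -> (p + t) %% n \in [:: a'; b'; z']) ->
  [\/ [/\ a != a', b + a' = b' + a & z + b' = z' + b],
      b + b' = z' + a /\ z + z' = a' + n + b |
      b + z' = a' + n + a /\ z + a' = b' + b].
Proof.
move=> t_bounds ab bz zn ab' bz' zn' sub.
have lt_tn : t < n by lia.
have lt_bn : b < n by lia.
have lt_an : a < n by lia.
have := sub a; have := sub b; have := sub z; rewrite !inE !eqxx !orbT /=.
have := modn_add_cases lt_an lt_tn; have := modn_add_cases lt_bn lt_tn.
have := modn_add_cases zn lt_tn.
move: (_ %% n) (_ %% n) (_ %% n) => u v w eu ev ew.
move=> /(_ isT)/or3P hw /(_ isT)/or3P hv /(_ isT)/or3P hu.
suff: (b + a' = b' + a /\ z + b' = z' + b /\ a <> a') \/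
   (b + b' = z' + a /\ z + z' = a' + n + b) \/
   (b + z' = a' + n + a /\ z + a' = b' + b).
  case=> [[h1 [h2 /eqP h3]]|[h|h]];
    by [constructor 1 | constructor 2 | constructor 3].
case: hw => /eqP ?; case: hv => /eqP ?; case: hu => /eqP ?; subst; lia.
Qed.

(** * The base partition *)

Definition swap_index m := m.-1./2.

(** An involution of [0, m), exchanging the two indices whose triples trade
    their middle points. *)
Definition middle m c :=
  if c == swap_index m then m.-1 else if c == m.-1 then swap_index m else c.

(** Colours [c < m] are the triples [{c, m + middle m c, 3m - 1 - c}]; the
    colour [m] is the pair [{3m, 3m + 1}]. *)
Definition base_colour m p :=
  if p < m then p
  else if p < 2 * m then middle m (p - m)
  else if p < 3 * m then 3 * m - 1 - p
  else m.

Lemma middle_cases m c : 2 < m -> c < m ->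
  [\/ c = swap_index m /\ middle m c = m.-1,
      c = m.-1 /\ middle m c = swap_index m |
      [/\ c <> swap_index m, c <> m.-1 & middle m c = c]].
Proof.
move=> m_gt2 lt_cm; rewrite /middle.
case: eqP => [->|ne_cj]; first by constructor 1.
by case: eqP => [->|ne_cm]; [constructor 2 | constructor 3].
Qed.

Lemma swap_index_bounds m : 2 < m ->
  [/\ 0 < swap_index m, m <= 2 * swap_index m + 2 & 2 * swap_index m < m].
Proof. by rewrite /swap_index => m_gt2; split; lia. Qed.

Lemma middleK m c : 2 < m -> c < m -> middle m (middle m c) = c.
Proof.
move=> m_gt2 lt_cm; have [j0 j1 j2] := swap_index_bounds m_gt2.
by rewrite /middle; repeat case: eqP => //; lia.
Qed.

Lemma middle_lt m c : 2 < m -> c < m -> middle m c < m.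
Proof.
move=> m_gt2 lt_cm; have [j0 j1 j2] := swap_index_bounds m_gt2.
by have [[]|[]|[]] := middle_cases m_gt2 lt_cm; lia.
Qed.

Lemma base_colour_triple m c p : 2 < m -> c < m ->
  (base_colour m p == c) = (p \in [:: c; m + middle m c; 3 * m - 1 - c]).
Proof.
move=> m_gt2 lt_cm; rewrite /base_colour !inE.
have lt_m := middle_lt m_gt2 lt_cm.
case: ltnP => [lt_pm | le_mp]; first by lia.
case: ltnP => [lt_p2m | le_2mp].
  have lt_pm : p - m < m by lia.
  have := middleK m_gt2 lt_cm; have := middleK m_gt2 lt_pm.
  case: (middle m (p - m) =P c) => [<-|ne_c] eq1 eq2; first by lia.
  suff: p <> m + middle m c by lia.
  by move=> eq_p; apply: ne_c; rewrite eq_p addKn.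
by case: ltnP => [lt_p3m | le_3mp]; lia.
Qed.

Lemma base_colour_pair m p : 2 < m -> (base_colour m p == m) = (3 * m <= p).
Proof.
move=> m_gt2; rewrite /base_colour.
case: ltnP => [lt_pm | le_mp]; first by lia.
case: ltnP => [lt_p2m | le_2mp]; last by case: ltnP; lia.
have lt_pm : p - m < m by lia.
by have := middle_lt m_gt2 lt_pm; lia.
Qed.

Lemma base_colour_le m p : 2 < m -> base_colour m p <= m.
Proof.
move=> m_gt2; rewrite /base_colour.
case: ltnP => [lt_pm | le_mp]; first by lia.
case: ltnP => [lt_p2m | le_2mp]; last by case: ltnP; lia.
have lt_pm : p - m < m by lia.
by have := middle_lt m_gt2 lt_pm; lia.
Qed.

Lemma triple_ordered m c : 2 < m -> c < m ->
  [/\ c < m + middle m c, m + middle m c < 3 * m - 1 - c,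
      1 < 3 * m - 1 - c - (m + middle m c) & 3 * m - 1 - c < 3 * m].
Proof.
move=> m_gt2 lt_cm; have [j0 j1 j2] := swap_index_bounds m_gt2.
by have [[]|[]|[]] := middle_cases m_gt2 lt_cm; split; lia.
Qed.

(** The unrotated case is excluded by the last gap, [2c + 3], which determines
    [c] and hence the smallest point, moved by the translation; a
    rotation is excluded by the gaps listed at the top. *)
Lemma triple_not_translate m t c c' : 2 < m -> 0 < t < 3 * m + 2 ->
  c < m -> c' < m ->
  ~ (forall p, p \in [:: c; m + middle m c; 3 * m - 1 - c] ->
     (p + t) %% (3 * m + 2) \in [:: c'; m + middle m c'; 3 * m - 1 - c']).
Proof.
move=> m_gt2 t_bounds lt_cm lt_cm' sub.
have [o1 o2 _ o3] := triple_ordered m_gt2 lt_cm.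
have [o1' o2' _ o3'] := triple_ordered m_gt2 lt_cm'.
have o4 : 3 * m - 1 - c < 3 * m + 2 by lia.
have o4' : 3 * m - 1 - c' < 3 * m + 2 by lia.
have [j0 j1 j2] := swap_index_bounds m_gt2.
have mc := middle_cases m_gt2 lt_cm; have mc' := middle_cases m_gt2 lt_cm'.
by case: (translate_triple t_bounds o1 o2 o4 o1' o2' o4' sub) => -[];
  case: mc => -[]; case: mc' => -[]; lia.
Qed.

(** All gaps of a triple exceed 1, while the points of the pair are cyclically
    consecutive. *)
Lemma pair_not_in_triple m t c : 2 < m -> 0 < t < 3 * m + 2 -> c < m ->
  ~ (forall p, 3 * m <= p < 3 * m + 2 ->
     (p + t) %% (3 * m + 2) \in [:: c; m + middle m c; 3 * m - 1 - c]).
Proof.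
move=> m_gt2 t_bounds lt_cm sub.
have [j0 j1 j2] := swap_index_bounds m_gt2.
have [o1 o2 o5 o3] := triple_ordered m_gt2 lt_cm.
have lt_t : t < 3 * m + 2 by lia.
have l0 : 3 * m < 3 * m + 2 by lia.
have l1 : 3 * m + 1 < 3 * m + 2 by lia.
have := sub (3 * m); have := sub (3 * m + 1); rewrite !inE.
have := modn_add_cases l0 lt_t; have := modn_add_cases l1 lt_t.
move: (_ %% _) (_ %% _) => u v ev eu /(_ ltac:(lia)) hv /(_ ltac:(lia)) hu.
have mc := middle_cases m_gt2 lt_cm.
by case/or3P: hu => /eqP ?; case/or3P: hv => /eqP ?; case: mc => -[]; lia.
Qed.

Lemma triple_not_in_pair m t c : 2 < m -> 0 < t < 3 * m + 2 -> c < m ->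
  ~ (forall p, p \in [:: c; m + middle m c; 3 * m - 1 - c] ->
     3 * m <= (p + t) %% (3 * m + 2)).
Proof.
move=> m_gt2 t_bounds lt_cm sub.
have [o1 o2 _ o3] := triple_ordered m_gt2 lt_cm.
have lt_t : t < 3 * m + 2 by lia.
have l0 : c < 3 * m + 2 by lia.
have l1 : m + middle m c < 3 * m + 2 by lia.
have l2 : 3 * m - 1 - c < 3 * m + 2 by lia.
have := sub c; have := sub (m + middle m c); have := sub (3 * m - 1 - c).
rewrite !inE !eqxx !orbT /=.
have := modn_add_cases l0 lt_t; have := modn_add_cases l1 lt_t.
have := modn_add_cases l2 lt_t.
have := ltn_pmod (c + t) (ltn0Sn (3 * m + 1)).
have := ltn_pmod (m + middle m c + t) (ltn0Sn (3 * m + 1)).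
have := ltn_pmod (3 * m - 1 - c + t) (ltn0Sn (3 * m + 1)).
rewrite -!addnS.
move: (_ %% _) (_ %% _) (_ %% _) => u v w lu lv lw eu ev ew.
by move=> /(_ isT) ? /(_ isT) ? /(_ isT) ?; lia.
Qed.

Lemma pair_not_translate m t : 0 < m -> 0 < t < 3 * m + 2 ->
  ~ (forall p, 3 * m <= p < 3 * m + 2 -> 3 * m <= (p + t) %% (3 * m + 2)).
Proof.
move=> m_gt0 t_bounds sub.
have lt_t : t < 3 * m + 2 by lia.
have l0 : 3 * m < 3 * m + 2 by lia.
have l1 : 3 * m + 1 < 3 * m + 2 by lia.
have := sub (3 * m); have := sub (3 * m + 1).
have := modn_add_cases l0 lt_t; have := modn_add_cases l1 lt_t.
have := ltn_pmod (3 * m + t) (ltn0Sn (3 * m + 1)).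
have := ltn_pmod (3 * m + 1 + t) (ltn0Sn (3 * m + 1)).
rewrite -!addnS.
move: (_ %% _) (_ %% _) => u v lu lv eu ev h0 h1.
by have := h0 ltac:(lia); have := h1 ltac:(lia); lia.
Qed.

Lemma base_colour_sperner m t c c' : 2 < m -> 0 < t < 3 * m + 2 ->
  c <= m -> c' <= m ->
  ~ (forall p, p < 3 * m + 2 -> base_colour m p = c ->
     base_colour m ((p + t) %% (3 * m + 2)) = c').
Proof.
move=> m_gt2 t_bounds le_cm le_cm' sub.
have {}sub p : p < 3 * m + 2 -> base_colour m p == c ->
    base_colour m ((p + t) %% (3 * m + 2)) == c'.
  by move=> lt_p /eqP/sub-> //.
have in_triple p : c < m -> p \in [:: c; m + middle m c; 3 * m - 1 - c] ->
    p < 3 * m + 2.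
  move=> lt_cm; have [o1 o2 _ o3] := triple_ordered m_gt2 lt_cm.
  by rewrite !inE => /or3P[]/eqP->; lia.
case: (ltngtP c m) le_cm => // [lt_cm | eq_cm] _;
  case: (ltngtP c' m) le_cm' => // [lt_cm' | eq_cm'] _.
- apply: (triple_not_translate m_gt2 t_bounds lt_cm lt_cm') => p p_in.
  rewrite -base_colour_triple //; apply: sub; first exact: in_triple p_in.
  by rewrite base_colour_triple.
- apply: (triple_not_in_pair m_gt2 t_bounds lt_cm) => p p_in.
  rewrite -base_colour_pair // -[X in _ == X]eq_cm'.
  apply: sub; first exact: in_triple p_in.
  by rewrite base_colour_triple.
- apply: (pair_not_in_triple m_gt2 t_bounds lt_cm') => p /andP[le_p lt_p].
  rewrite -base_colour_triple //.
  by apply: sub; rewrite // eq_cm base_colour_pair.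
apply: (pair_not_translate (ltnW (ltnW m_gt2)) t_bounds) => p /andP[le_p lt_p].
rewrite -base_colour_pair // -[X in _ == X]eq_cm'.
by apply: sub; rewrite // eq_cm base_colour_pair.
Qed.

Theorem theorem5p1 (k : nat) (hk : 3 < k) : 3 * k - 1 <= SP (3 * k - 1) k.
Proof.
case: k hk => // m m_gt2.
rewrite (_ : 3 * m.+1 - 1 = 3 * m + 2); last by lia.
have colK p : (inord (base_colour m p) : 'I_m.+1) = base_colour m p :> nat.
  by apply: inordK; rewrite ltnS base_colour_le.
apply: (@SP_cyclic _ _ (fun p => inord (base_colour m p) : 'I_m.+1)) => //.
  move=> c; case: (ltngtP c m) (leq_ord c) => // [lt_cm | eq_cm] _.
    exists (c : nat); first by lia.
    by apply: val_inj; rewrite /= colK /base_colour lt_cm.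
  exists (3 * m); first by lia.
  by apply: val_inj; rewrite /= colK eq_cm; apply/eqP; rewrite base_colour_pair.
move=> t c c' t_bounds.
pose bad (p : 'I_(3 * m + 2)) := (base_colour m p == c) &&
  (base_colour m ((p + t) %% (3 * m + 2)) != c').
case: (pickP bad) => [p /andP[col_p col_pt] | no_bad].
  exists (val p); split; first exact: ltn_ord.
    by apply: val_inj; rewrite /= colK; apply/eqP.
  by rewrite -val_eqE /= colK.
case: (base_colour_sperner m_gt2 t_bounds (leq_ord c) (leq_ord c')).
move=> p lt_p col_p; have := no_bad (Ordinal lt_p).
by rewrite /bad /= col_p eqxx /= => /negbFE/eqP.
Qed.
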